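(* Let $L$ be the second-order monadic logic of order together with a binary predicate $B(t,s)$, interpreted on the whole real line $\mathbb{R}$ as $s=t+1$. Let $L_1$ be a temporal logic with possibly infinitely many modalities, such that for some natural number $m$ every modality of $L_1$ has a truth table in $L$ of quantifier depth at most $m$. Then there is some $n$ such that the counting modality $C_n(X)$ is not equivalent over the real line to any $L_1$ formula; i.e. there is no $L_1$ formula $\varphi$ such that for all predicates on $\mathbb{R}$ and all $t\in\mathbb{R}$, $\varphi$ holds at $t$ iff $C_n(X)$ holds at $t$.
   Context: Formulas of $L$ are built from atomic formulas $X(t)$, $t_1=t_2$, $t_1<t_2$, $B(t_1,t_2)$ (with $t,t_i$ first-order variables ranging over $\mathbb{R}$ and $X$ monadic predicate variables ranging over subsets of $\mathbb{R}$) using Boolean connectives, first-order quantifiers $\exists t,\forall t$ and second-order quantifiers $\exists X,\forall X$; quantifier depth counts nesting of both kinds of quantifiers. Temporal logic formulas are built by the grammar $\varphi::=\mathit{True}\mid P\mid\neg\varphi\mid\varphi\wedge\varphi\mid O(\varphi_1,\dots,\varphi_k)$ with $P$ monadic predicate names and $O$ modalities. A truth table for a $k$-ary modality $O$ is a formula $\overline O(t_0,X_1,\dots,X_k)$ of $L$ with free first-order variable $t_0$ and free predicate variables $X_1,\dots,X_k$; semantics: $P$ holds at $t$ iff $t\in P$, Booleans as usual, and $O(\varphi_1,\dots,\varphi_k)$ holds at $t$ iff $\overline O(t,A_{\varphi_1},\dots,A_{\varphi_k})$ is true in $\mathbb{R}$, where $A_{\varphi_i}$ is the set of points where $\varphi_i$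 holds. The counting modality $C_n(X)$ holds at $t_0$ iff there are at least $n$ distinct points $t$ with $t_0<t<t_0+1$ and $X(t)$. *)

(* Defs.v *)
From HB Require Import structures.
From mathcomp Require Import all_boot all_order all_algebra.
From mathcomp Require Import classical_sets reals.

Set Implicit Arguments.
Unset Strict Implicit.
Unset Printing Implicit Defensive.

Import Order.TTheory GRing.Theory Num.Theory.
Local Open Scope classical_set_scope.
Local Open Scope ring_scope.

(* Well-scoped de Bruijn syntax: the free first-order variables of a formula
   in [mso a k] are the elements of 'I_a, its free predicate variables those
   of 'I_k.  A quantifier binds index [ord0] of its body and shifts the other
   variables of that sort by [lift ord0]. *)
Inductive mso : nat -> nat -> Type :=
| MsoIn a k of 'I_k & 'I_a : mso a k
| MsoEq a k of 'I_a & 'I_a : mso a k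
| MsoLt a k of 'I_a & 'I_a : mso a k
| MsoB a k of 'I_a & 'I_a : mso a k
| MsoNot a k of mso a k : mso a k
| MsoAnd a k of mso a k & mso a k : mso a k
| MsoOr a k of mso a k & mso a k : mso a k
| MsoImp a k of mso a k & mso a k : mso a k
| MsoEx1 a k of mso a.+1 k : mso a k
| MsoAll1 a k of mso a.+1 k : mso a k
| MsoEx2 a k of mso a k.+1 : mso a k
| MsoAll2 a k of mso a k.+1 : mso a k.

Fixpoint qdepth a k (f : mso a k) : nat :=
  match f with
  | MsoIn _ _ _ _ | MsoEq _ _ _ _ | MsoLt _ _ _ _ | MsoB _ _ _ _ => 0%N
  | MsoNot _ _ g => qdepth g
  | MsoAnd _ _ g h | MsoOr _ _ g h | MsoImp _ _ g h =>
      maxn (qdepth g) (qdepth h)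
  | MsoEx1 _ _ g | MsoAll1 _ _ g => (qdepth g).+1
  | MsoEx2 _ _ g | MsoAll2 _ _ g => (qdepth g).+1
  end.

Definition env_cons (T : Type) (n : nat) (x : T) (e : 'I_n -> T)
  (i : 'I_n.+1) : T := if unlift ord0 i is Some j then e j else x.

Fixpoint mso_sat (R : realType) a k (f : mso a k) :
    ('I_a -> R) -> ('I_k -> set R) -> Prop :=
  match f in mso a k return ('I_a -> R) -> ('I_k -> set R) -> Prop with
  | MsoIn _ _ i x => fun u U => U i (u x)
  | MsoEq _ _ x y => fun u U => u x = u y
  | MsoLt _ _ x y => fun u U => u x < u y
  | MsoB _ _ x y => fun u U => u y = u x + 1
  | MsoNot _ _ g => fun u U => ~ mso_sat g u U
  | MsoAnd _ _ g h => fun u U => mso_sat g u U /\ mso_sat h u U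
  | MsoOr _ _ g h => fun u U => mso_sat g u U \/ mso_sat h u U
  | MsoImp _ _ g h => fun u U => mso_sat g u U -> mso_sat h u U
  | MsoEx1 _ _ g => fun u U => exists t : R, mso_sat g (env_cons t u) U
  | MsoAll1 _ _ g => fun u U => forall t : R, mso_sat g (env_cons t u) U
  | MsoEx2 _ _ g => fun u U => exists A : set R, mso_sat g u (env_cons A U)
  | MsoAll2 _ _ g => fun u U => forall A : set R, mso_sat g u (env_cons A U)
  end.

(* A temporal logic is given by its modalities, each with its truth table: a
   formula with the single free first-order variable t_0 and one free predicate
   variable per argument. *)
Record temporal_logic := TemporalLogic {
  modality : Type;
  arity : modality -> nat;
  truth_table : forall o : modality, mso 1 (arity o) }.

Inductive tformula (L : temporal_logic) (Pred : Type) : Type :=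
| TTrue
| TAtom of Pred
| TNot of tformula L Pred
| TAnd of tformula L Pred & tformula L Pred
| TMod (o : modality L) of ('I_(arity o) -> tformula L Pred).

Fixpoint tsat (R : realType) (L : temporal_logic) (Pred : Type)
    (V : Pred -> set R) (phi : tformula L Pred) (t : R) : Prop :=
  match phi with
  | TTrue => True
  | TAtom P => V P t
  | TNot psi => ~ tsat V psi t
  | TAnd psi chi => tsat V psi t /\ tsat V chi t
  | TMod o args =>
      mso_sat (truth_table o) (fun=> t) (fun i => [set s | tsat V (args i) s])
  end.

Definition counting (R : realType) (n : nat) (X : set R) (t0 : R) : Prop :=
  exists p : 'I_n -> R,
    injective p /\ forall i, t0 < p i /\ p i < t0 + 1 /\ X (p i).

(* Main.v *)
Require Import Defs.
From mathcomp Require Import all_boot all_order all_algebra.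
From mathcomp Require Import classical_sets reals.
From mathcomp Require Import boolp ring lra zify.

(** Let [X_n] be the set of multiples of [1/n].  The automorphisms of
    [(R, <, +1, X_n)] act transitively on [X_n] and on its complement, so that
    over [X_n] every temporal formula defines one of the four sets: empty,
    [X_n], its complement, and the line.  A modality applied to such sets is a
    formula of depth [m] about [t_0] and these four predicates, and there are
    only finitely many depth-[m] types of such structures.  By the pigeonhole
    principle some [n1 < n2] give the same types, and then every temporal
    formula defines the same one of the four sets over [X_n1] and over [X_n2];
    but [C_n2] holds off [X_n2] and fails off [X_n1]. *)

Set Implicit Arguments.
Unset Strict Implicit.
Unset Printing Implicit Defensive.

Import Order.TTheory GRing.Theory Num.Theory.
Local Open Scope classical_set_scope.
Local Open Scope ring_scope.

(** * Environments and finite types of depth [d] *)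

Definition opt_cons (T I : Type) (x : T) (e : I -> T) (o : option I) : T :=
  if o is Some i then e i else x.

Definition env_lift (n : nat) (I : Type) (s : 'I_n -> I) :
    'I_n.+1 -> option I :=
  env_cons None (Some \o s).

Lemma opt_cons_lift (T I : Type) (n : nat) (x : T) (e : I -> T)
    (s : 'I_n -> I) :
  opt_cons x e \o env_lift s = env_cons x (e \o s).
Proof.
by apply/funext => i; rewrite /env_lift /= /env_cons; case: unlift.
Qed.

Lemma comp_opt_cons (S T I : Type) (g : S -> T) (x : S) (e : I -> S) :
  g \o opt_cons x e = opt_cons (g x) (g \o e).
Proof. by apply/funext => -[]. Qed.

Section Rank.
Variable R : realType.

Definition diagram_type (J I : finType) : finType :=
  ({ffun J * I -> bool} * {ffun J * J -> bool * bool * bool})%type.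

Definition diagram (J I : finType) (u : J -> R) (U : I -> set R) :
    diagram_type J I :=
  ([ffun p => `[< U p.2 (u p.1) >]],
   [ffun p => (u p.1 == u p.2, u p.1 < u p.2, u p.2 == u p.1 + 1)]).

(** Being a [finType], it makes the pigeonhole principle directly applicable. Contexts are indexed
    by arbitrary finite types, with [option] for a fresh variable, so that the four sets can form a
    context indexed by [bool * bool]. *)
Fixpoint rank_type (d : nat) (J I : finType) : finType :=
  if d is d'.+1 then
    (diagram_type J I *
      ({set rank_type d' (option J) I} * {set rank_type d' J (option I)}))%type
  else diagram_type J I.

(** The [d]-round Ehrenfeucht-Fraisse type: equality of ranks means that Duplicator wins the game
    with point and set moves. *)
Fixpoint rank (d : nat) : forall (J I : finType),
    (J -> R) -> (I -> set R) -> rank_type d J I :=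
  match d return forall J I : finType,
      (J -> R) -> (I -> set R) -> rank_type d J I with
  | 0 => fun J I u U => diagram u U
  | d'.+1 => fun J I u U =>
      (diagram u U,
       ([set r | `[< exists t, rank d' (opt_cons t u) U = r >]]%SET,
        [set r | `[< exists A, rank d' u (opt_cons A U) = r >]]%SET))
  end.

Lemma rank_diagram d (J I : finType) (u u' : J -> R) (U U' : I -> set R) :
  rank d u U = rank d u' U' -> diagram u U = diagram u' U'.
Proof. by case: d => // d /(congr1 fst). Qed.

Lemma diagram_in (J I : finType) (u u' : J -> R) (U U' : I -> set R) j i :
  diagram u U = diagram u' U' -> U i (u j) <-> U' i (u' j).
Proof.
case=> /ffunP /(_ (j, i)) + _; rewrite !ffunE /= => e.
by split=> /asboolP; [rewrite e | rewrite -e] => /asboolP.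
Qed.

Lemma diagram_rel (J I : finType) (u u' : J -> R) (U U' : I -> set R) i j :
  diagram u U = diagram u' U' ->
  [/\ (u i == u j) = (u' i == u' j), (u i < u j) = (u' i < u' j)
    & (u j == u i + 1) = (u' j == u' i + 1)].
Proof. by case=> _ /ffunP /(_ (i, j)); rewrite !ffunE => -[-> -> ->]. Qed.

Lemma rank_ex1 d (J I : finType) (u u' : J -> R) (U U' : I -> set R) t :
  rank d.+1 u U = rank d.+1 u' U' ->
  exists t', rank d (opt_cons t u) U = rank d (opt_cons t' u') U'.
Proof.
move=> /(congr1 (fun r => r.2.1)) /setP /(_ (rank d (opt_cons t u) U)).
rewrite !inE => e; have /asboolP [t' <-] : `[< exists t' : R,
    rank d (opt_cons t' u') U' = rank d (opt_cons t u) U >].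
  by rewrite -e; apply/asboolP; exists t.
by exists t'.
Qed.

Lemma rank_ex2 d (J I : finType) (u u' : J -> R) (U U' : I -> set R) A :
  rank d.+1 u U = rank d.+1 u' U' ->
  exists A', rank d u (opt_cons A U) = rank d u' (opt_cons A' U').
Proof.
move=> /(congr1 (fun r => r.2.2)) /setP /(_ (rank d u (opt_cons A U))).
rewrite !inE => e; have /asboolP [A' <-] : `[< exists A' : set R,
    rank d u' (opt_cons A' U') = rank d u (opt_cons A U) >].
  by rewrite -e; apply/asboolP; exists A.
by exists A'.
Qed.

(** Induction on the formula, each quantifier using up one round. Variables are read through [r] and
    [s], which need not be injective: a modality of any arity, applied to only four sets, is thus
    governed by one fixed finite context. One implication suffices, since equality of ranks is
    symmetric. *)
Lemma rank_sat a k (f : mso a k) d (J I : finType) (r : 'I_a -> J)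
    (s : 'I_k -> I) (u u' : J -> R) (U U' : I -> set R) :
  (qdepth f <= d)%N -> rank d u U = rank d u' U' ->
  mso_sat f (u \o r) (U \o s) -> mso_sat f (u' \o r) (U' \o s).
Proof.
elim: f d J I r s u u' U U' => {a k} /=.
- move=> a k i x d J I r s u u' U U' _ /rank_diagram e.
  by have [h _] := diagram_in (r x) (s i) e; exact: h.
- move=> a k x y d J I r s u u' U U' _ /rank_diagram.
  by case/(diagram_rel (r x) (r y)) => e _ _ /eqP; rewrite e => /eqP.
- move=> a k x y d J I r s u u' U U' _ /rank_diagram.
  by case/(diagram_rel (r x) (r y)) => _ -> _.
- move=> a k x y d J I r s u u' U U' _ /rank_diagram.
  by case/(diagram_rel (r x) (r y)) => _ _ e /eqP; rewrite e => /eqP.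
- by move=> a k g IH d J I r s u u' U U' hd /esym e ng /(IH _ _ _ _ _ _ _ _ _ hd e).
- move=> a k g IHg h IHh d J I r s u u' U U'; rewrite geq_max => /andP[hg hh] e.
  by case=> /(IHg _ _ _ _ _ _ _ _ _ hg e) ? /(IHh _ _ _ _ _ _ _ _ _ hh e).
- move=> a k g IHg h IHh d J I r s u u' U U'; rewrite geq_max => /andP[hg hh] e.
  by case=> [/(IHg _ _ _ _ _ _ _ _ _ hg e)|/(IHh _ _ _ _ _ _ _ _ _ hh e)]; [left|right].
- move=> a k g IHg h IHh d J I r s u u' U U'; rewrite geq_max => /andP[hg hh] e.
  move=> gh /(IHg _ _ _ _ _ _ _ _ _ hg (esym e)) /gh.
  exact: IHh hh e.
- move=> a k g IH [//|d] J I r s u u' U U' hd e [t].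
  have [t' e'] := rank_ex1 t e.
  by rewrite -opt_cons_lift => /(IH _ _ _ _ _ _ _ _ _ hd e') ?; exists t';
    rewrite -opt_cons_lift.
- move=> a k g IH [//|d] J I r s u u' U U' hd e gt t.
  have [t' /esym e'] := rank_ex1 t (esym e).
  by rewrite -opt_cons_lift; apply: IH hd e' _; rewrite opt_cons_lift.
- move=> a k g IH [//|d] J I r s u u' U U' hd e [A].
  have [A' e'] := rank_ex2 A e.
  by rewrite -opt_cons_lift => /(IH _ _ _ _ _ _ _ _ _ hd e') ?; exists A';
    rewrite -opt_cons_lift.
- move=> a k g IH [//|d] J I r s u u' U U' hd e gA A.
  have [A' /esym e'] := rank_ex2 A (esym e).
  by rewrite -opt_cons_lift; apply: IH hd e' _; rewrite opt_cons_lift.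
Qed.

(** A new point [z] on the left is matched by [g z] on the right, a new set [A] on the right by
    [A \o g] on the left; invertibility of [g] makes both matchings exhaustive. *)
Lemma rank_automorphism (g g' : R -> R) d (J I : finType) (u : J -> R)
    (U : I -> set R) :
  cancel g g' -> cancel g' g -> {mono g : x y / x < y} ->
  (forall x, g (x + 1) = g x + 1) ->
  rank d u (fun i => U i \o g) = rank d (g \o u) U.
Proof.
move=> gK g'K gmono g1.
have ginj := can_inj gK.
have diag (J' I' : finType) (v : J' -> R) (W : I' -> set R) :
    diagram v (fun i => W i \o g) = diagram (g \o v) W.
  congr pair; apply/ffunP => p; rewrite !ffunE //=.
  by rewrite (inj_eq ginj) gmono -g1 (inj_eq ginj).
elim: d J I u U => [|d IH] J I u U; first exact: diag.
have shift (W : I -> set R) A :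
    (fun i => opt_cons (A : set R) W i \o g) = opt_cons (A \o g) (fun i => W i \o g).
  by apply/funext => -[].
rewrite /= diag; congr (_, (_, _)); apply/setP => r; rewrite !inE;
  apply/asboolP/asboolP => -[z <-].
- by exists (g z); rewrite IH comp_opt_cons.
- by exists (g' z); rewrite IH comp_opt_cons g'K.
- exists (z \o g'); rewrite -IH shift; congr (rank d u (opt_cons _ _)).
  by apply/funext => x /=; rewrite gK.
- by exists (z \o g); rewrite -shift IH.
Qed.

End Rank.

(** * Automorphisms of the line with order and unit shift that preserve the integers *)

Section Warp.
Variable R : realType.
Implicit Types (p q x y : R) (e : int).

(* A Moebius map of [0, 1) onto itself; its inverse exchanges [p] and [q]. *)
Definition bend p q x : R := p * x / (q * (1 - x) + p * x).

Lemma bend_den_gt0 p q x : 0 < p -> 0 < q -> 0 <= x < 1 ->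
  0 < q * (1 - x) + p * x.
Proof. by move=> p0 q0 /andP[x0 x1]; nra. Qed.

Lemma bend_itv p q x : 0 < p -> 0 < q -> 0 <= x < 1 -> 0 <= bend p q x < 1.
Proof.
move=> p0 q0 hx; have D := bend_den_gt0 p0 q0 hx; case/andP: hx => x0 x1.
by rewrite /bend divr_ge0 ?(ltW D) ?mulr_ge0 ?(ltW p0) //= ltr_pdivrMr //; nra.
Qed.

Lemma bendK p q x : 0 < p -> 0 < q -> 0 <= x < 1 -> bend q p (bend p q x) = x.
Proof.
move=> p0 q0 hx; have D := bend_den_gt0 p0 q0 hx.
rewrite /bend; field.
rewrite (gt_eqF D) /=.
have -> : p * (q * (1 - x) + p * x - p * x) + q * (p * x) = p * q by ring.
by rewrite mulf_neq0 // gt_eqF.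
Qed.

Lemma bend_lt p q x y : 0 < p -> 0 < q -> 0 <= x < 1 -> 0 <= y < 1 -> x < y ->
  bend p q x < bend p q y.
Proof.
move=> p0 q0 hx hy xy.
have Dx := bend_den_gt0 p0 q0 hx; have Dy := bend_den_gt0 p0 q0 hy.
rewrite /bend ltr_pdivrMr // mulrAC ltr_pdivlMr // -subr_gt0.
have -> : p * y * (q * (1 - x) + p * x) - p * x * (q * (1 - y) + p * y) =
  p * q * (y - x) by ring.
by rewrite mulr_gt0 ?mulr_gt0 ?subr_gt0.
Qed.

Definition frac x : R := x - (Num.floor x)%:~R.

Lemma frac_itv x : 0 <= frac x < 1.
Proof.
have /andP[h1 h2] := floor_itv x; rewrite intrD in h2.
by rewrite /frac subr_ge0 h1 /=; lra.
Qed.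

(** Bending every unit interval in the same way makes the map commute with integer translations. *)
Definition warp e p q x : R := (Num.floor x + e)%:~R + bend p q (frac x).

Lemma floor_intrD (k : int) y : 0 <= y < 1 -> Num.floor (k%:~R + y) = k.
Proof.
by move=> /andP[y0 y1]; apply/floor_def; rewrite intrD; apply/andP; split; lra.
Qed.

Lemma warp_floor e p q x : 0 < p -> 0 < q ->
  Num.floor (warp e p q x) = Num.floor x + e.
Proof. by move=> p0 q0; rewrite floor_intrD // bend_itv // frac_itv. Qed.

Lemma warp_frac e p q x : 0 < p -> 0 < q ->
  frac (warp e p q x) = bend p q (frac x).
Proof. by move=> p0 q0; rewrite /frac warp_floor // /warp addrC addKr. Qed.

Lemma warpK e p q : 0 < p -> 0 < q -> cancel (warp e p q) (warp (- e) q p).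
Proof.
move=> p0 q0 x; rewrite {1}/warp warp_floor // warp_frac // bendK ?frac_itv //.
by rewrite addrK /frac addrC subrK.
Qed.

Lemma warp_lt e p q : 0 < p -> 0 < q -> {homo warp e p q : x y / x < y}.
Proof.
move=> p0 q0 x y xy.
have /andP[bx0 bx1] := bend_itv p0 q0 (frac_itv x).
have /andP[by0 by1] := bend_itv p0 q0 (frac_itv y).
(* Either both points share a unit interval, where [bend] is increasing, or their images lie in
   different unit intervals, in the same order. *)
have := le_floor (ltW xy); rewrite le_eqVlt => /predU1P[fl|fl].
  by rewrite /warp fl ltrD2l bend_lt ?frac_itv // /frac fl ltrD2r.
rewrite /warp; have : (Num.floor x + e + 1)%:~R <= (Num.floor y + e)%:~R :> R.
  by rewrite ler_int; lia.
by rewrite intrD; lra.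
Qed.

(** Needed beyond [n = 1] because scaling a grid to the integers turns the unit shift into a shift
    by the number of grid steps per unit. *)
Lemma warpDn e p q x n : warp e p q (x + n%:R) = warp e p q x + n%:R.
Proof.
have fl : Num.floor (x + n%:R) = Num.floor x + n%:Z.
  by rewrite -[n%:R]pmulrn floorDrz ?intr_int // pmulrn intrKfloor.
rewrite /warp /frac fl -addrA [_ + e]addrC !intrD -!pmulrn.
rewrite [in bend _ _ _](_ : _ - _ = x - (Num.floor x)%:~R) ?addrA; ring.
Qed.

Lemma int_frac x : (x \is a Num.int) = (frac x == 0).
Proof. by rewrite intrEfloor eq_sym subr_eq0. Qed.

Lemma warp_int e p q x : 0 < p -> 0 < q ->
  (warp e p q x \is a Num.int) = (x \is a Num.int).
Proof.
move=> p0 q0; rewrite !int_frac warp_frac //.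
rewrite mulf_eq0 invr_eq0 mulf_eq0 (gt_eqF p0) /=.
by rewrite (gt_eqF (bend_den_gt0 p0 q0 (frac_itv x))) orbF.
Qed.

(** The translation [e] adjusts the integer part, and a nonzero fractional part can be bent to any
    other. *)
Lemma warp_transitive x y : (x \is a Num.int) = (y \is a Num.int) ->
  exists e p q, [/\ 0 < p, 0 < q & warp e p q x = y].
Proof.
rewrite !int_frac => xy; exists (Num.floor y - Num.floor x).
have yE : y = (Num.floor y)%:~R + frac y by rewrite addrC subrK.
rewrite /warp addrC subrK.
have /andP[x0 x1] := frac_itv x; have /andP[y0 y1] := frac_itv y.
have [x_0|x_n0] := eqVneq (frac x) 0.
  exists 1, 1; split=> //; rewrite {2}yE x_0 /bend mulr0 mul0r.
  by move: xy; rewrite x_0 eqxx => /esym/eqP ->.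
have xp : 0 < frac x by rewrite lt_def x_n0.
have yp : 0 < frac y by rewrite lt_def y0 -xy x_n0.
(* These weights solve [bend p q (frac x) = frac y], that is, [p * frac x * (1 - frac y) = q * frac
   y * (1 - frac x)]. *)
exists (frac y * (1 - frac x)), (frac x * (1 - frac y)).
split; [by rewrite mulr_gt0 // subr_gt0 | by rewrite mulr_gt0 // subr_gt0 |].
rewrite [RHS]yE; congr (_ + _); rewrite /bend; field.
have -> : frac x * (1 - frac y) * (1 - frac x) + frac y * (1 - frac x) * frac x =
  frac x * (1 - frac x) by ring.
by rewrite mulf_neq0 // gt_eqF // subr_gt0.
Qed.

End Warp.

(** * The grid of spacing [1 / (n + 1)] and its two orbits *)

Section Grid.
Variable R : realType.

(* Indexed so that the spacing is [1 / (n + 1)], never [1 / 0]. *)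
Definition grid (n : nat) : set R := [set x | x * n.+1%:R \is a Num.int].

(** The four unions of orbits. Their codes do not depend on [n], which lets different grids be
    compared. *)
Definition grid_sets (n : nat) (bc : bool * bool) : set R :=
  [set x | if x * n.+1%:R \is a Num.int then bc.1 else bc.2].

(** Half a grid step above 0: a representative of the complement whose open unit interval to the
    right holds exactly [n + 1] grid points. *)
Definition off_grid (n : nat) : R := (2 * n.+1%:R)^-1.

Lemma off_gridM n : off_grid n * n.+1%:R = 2^-1.
Proof. by rewrite /off_grid invfM mulfVK // pnatr_eq0. Qed.

Lemma off_gridP n : (off_grid n * n.+1%:R \is a Num.int) = false.
Proof.
rewrite off_gridM intrEfloor; apply/negbTE.
have -> : Num.floor (2^-1 : R) = 0 by apply/floor_def; rewrite /=; lra.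
by rewrite eq_sym invr_eq0 pnatr_eq0.
Qed.

Lemma grid_rank n d (x y : R) :
  (x * n.+1%:R \is a Num.int) = (y * n.+1%:R \is a Num.int) ->
  rank d (fun _ : unit => x) (grid_sets n) =
    rank d (fun _ : unit => y) (grid_sets n).
Proof.
set N : R := n.+1%:R => /warp_transitive [e [p [q [p0 q0 exy]]]].
have N0 : 0 < N by rewrite ltr0n.
have Nn0 : N != 0 by rewrite gt_eqF.
(* The warp is conjugated by the scaling that takes the grid to the integers. *)
pose g e p q (z : R) := warp e p q (z * N) / N.
have gK e1 p1 q1 : 0 < p1 -> 0 < q1 -> cancel (g e1 p1 q1) (g (- e1) q1 p1).
  by move=> p10 q10 z; rewrite /g divfK // warpK // mulfK.
have gmono : {mono g e p q : z1 z2 / z1 < z2}.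
  apply/leW_mono/le_mono => z1 z2 z12.
  by rewrite /g ltr_pM2r ?invr_gt0 // warp_lt // ltr_pM2r.
have g1 z : g e p q (z + 1) = g e p q z + 1.
  by rewrite /g [(z + 1) * N]mulrDl mul1r warpDn [LHS]mulrDl divff.
have g'K : cancel (g (- e) q p) (g e p q).
  by rewrite -{2}[e]opprK; apply: gK.
have -> : (fun _ : unit => y) = g e p q \o (fun=> x).
  by apply/funext => _ /=; rewrite /g exy mulfK.
rewrite -(rank_automorphism _ _ _ (gK _ _ _ p0 q0) g'K gmono g1).
congr (rank d _ _); apply/funext => bc; apply/funext => z.
by rewrite /grid_sets /= /g divfK // warp_int.
Qed.

Lemma counting_off_grid n : counting n.+1 (grid n) (off_grid n).
Proof.
have N0 : 0 < n.+1%:R :> R by rewrite ltr0n.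
have o0 : 0 < off_grid n by rewrite invr_gt0 mulr_gt0.
exists (fun i => i.+1%:R / n.+1%:R); split.
  move=> i j /(mulIf (invr_neq0 (lt0r_neq0 N0))) /eqP.
  by rewrite eqr_nat eqSS => /eqP/val_inj.
move=> i; split; first last.
  split; last by rewrite /grid /= divfK ?gt_eqF // natr_int.
  apply: (@le_lt_trans _ _ 1); last by lra.
  by rewrite ler_pdivrMr // mul1r ler_nat.
rewrite ltr_pdivlMr // off_gridM.
have : 1 <= i.+1%:R :> R by rewrite ler1n.
by lra.
Qed.

Lemma counting_off_grid_le k n : counting k (grid n) (off_grid n) ->
  (k <= n.+1)%N.
Proof.
have N0 : 0 < n.+1%:R :> R by rewrite ltr0n.
move=> [f [finj fP]].
(* Scaled by [n + 1], the interval runs from 1/2 to n + 3/2, so the integers inside it are 1, ..., n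
   + 1. *)
have fE i : exists j : 'I_n.+1, f i * n.+1%:R = j.+1%:R.
  have [lo [hi /intrP[z zE]]] := fP i.
  have : 2^-1 < z%:~R :> R by rewrite -zE -(off_gridM n) ltr_pM2r.
  have : z%:~R < (2^-1 + n.+1%:R : R).
    by rewrite -zE -(off_gridM n) -{3}[n.+1%:R]mul1r -mulrDl ltr_pM2r.
  move=> h1 h2.
  have z0 : (0 < z)%R by rewrite -(ltr_int R); lra.
  have zn : (z < n.+2%:Z)%R.
    by rewrite -(ltr_int R) -pmulrn -[n.+2%:R]natr1; lra.
  case: z zE z0 zn {h1 h2} => [[//|j]|//] zE _ jn.
  have jn' : (j < n.+1)%N by lia.
  by exists (Ordinal jn').
have [h hE] := choice fE.
have hinj : injective h.
  move=> i j hij; apply/finj/(mulIf (lt0r_neq0 N0)).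
  by rewrite !hE hij.
by have := leq_card h hinj; rewrite !card_ord.
Qed.

End Grid.

(** * Pigeonhole and the comparison of two grids *)

Lemma pigeonhole (T : finType) (f : nat -> T) :
  exists n1 n2, (n1 < n2)%N /\ f n1 = f n2.
Proof.
have /injectivePn [i [j ij fij]] : ~~ injectiveb (fun i : 'I_#|T|.+1 => f i).
  by apply/injectiveP => /leq_card; rewrite card_ord ltnn.
have := ij; rewrite -val_eqE neq_ltn => /orP[] ?.
  by exists i, j.
by exists j, i.
Qed.

(** Induction on [phi]. One code [bc] has to serve both grids, so that the arguments of a modality
    correspond over [n1] and [n2] and equal ranks can be applied to its truth table. *)
Lemma tsat_grid (R : realType) (L : temporal_logic) (Pred : Type)
    (m n1 n2 : nat) (phi : tformula L Pred) :
  (forall o : modality L, (qdepth (truth_table o) <= m)%N) ->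
  rank m (fun _ : unit => 0 : R) (grid_sets n1) =
    rank m (fun _ : unit => 0 : R) (grid_sets n2) ->
  rank m (fun _ : unit => off_grid R n1) (grid_sets n1) =
    rank m (fun _ : unit => off_grid R n2) (grid_sets n2) ->
  exists bc, forall n, n = n1 \/ n = n2 ->
    forall t : R, tsat (fun=> grid n) phi t <-> grid_sets n bc t.
Proof.
move=> hm e0 e1; rewrite /grid_sets.
elim: phi => [|P|phi [bc IH]|phi [bc IHp] psi [bc' IHq]|o args IH].
- by exists (true, true) => n _ t /=; case: ifP.
- by exists (true, false) => n _ t /=; rewrite /grid /=; case: ifP.
- exists (~~ bc.1, ~~ bc.2) => n /IH {}IH t /=; rewrite IH /=.
  by case: ifP => _; split=> /negP.
- exists (bc.1 && bc'.1, bc.2 && bc'.2) => n hn t /=.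
  by rewrite (IHp n hn) (IHq n hn) /=; case: ifP => _; split=> /andP.
have [s sE] := choice IH.
pose sat n (t : R) := mso_sat (truth_table o) (fun=> t) (grid_sets n \o s).
have argsE n : n = n1 \/ n = n2 ->
    (fun i => [set x : R | tsat (fun=> grid n) (args i) x]) = grid_sets n \o s.
  by move=> hn; apply/funext => i; apply/funext => x; apply/propext; exact: sE.
(* The code is read off at one representative of each orbit over [n1]. *)
exists (`[< sat n1 0 >], `[< sat n1 (off_grid R n1) >]) => n hn t /=.
rewrite (argsE n hn).
(* [grid_rank] moves [t] to the representative of its orbit over [n]; if [n] is [n2], then [e0] or
   [e1] carries that to [t1] over [n1]. *)
pose t1 := if t * n.+1%:R \is a Num.int then 0 else off_grid R n1.
have eq_rank : rank m (fun _ : unit => t) (grid_sets n) =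
    rank m (fun _ : unit => t1) (grid_sets n1).
  rewrite /t1; case: ifPn => [tint|/negbTE tint].
    rewrite (@grid_rank _ n m t 0) ?mul0r ?tint ?rpred0 //.
    by case: hn => ->.
  rewrite (@grid_rank _ n m t (off_grid R n)) ?off_gridP //.
  by case: hn => ->.
have -> : mso_sat (truth_table o) (fun=> t) (grid_sets n \o s) <-> sat n1 t1.
  pose r (_ : 'I_1) := tt.
  by split; [exact: (rank_sat (r := r) (hm o) eq_rank)
            |exact: (rank_sat (r := r) (hm o) (esym eq_rank))].
by rewrite /t1; case: ifP => _; split=> /asboolP.
Qed.

Theorem theorem4p1 (R : realType) (L1 : temporal_logic)
    (Pred : Type) (X : Pred)
    (hL1 : exists m : nat, forall o : modality L1,
       (qdepth (truth_table o) <= m)%N) :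
  exists n : nat, ~ exists phi : tformula L1 Pred,
    forall (V : Pred -> set R) (t : R),
      tsat V phi t <-> counting n (V X) t.
Proof.
have [m hm] := hL1.
have [n1 [n2 [n12 [e0 e1]]]] := pigeonhole (fun n =>
  (rank m (fun _ : unit => 0 : R) (grid_sets n),
   rank m (fun _ : unit => off_grid R n) (grid_sets n))).
(* To the right of [off_grid] the grid of [n2] offers [n2 + 1] points, that of [n1] only [n1 + 1];
   yet [phi] takes the common value [bc.2] off both grids. *)
exists n2.+1 => -[phi hphi].
have [bc bcE] := tsat_grid phi hm e0 e1.
have /hphi/(bcE _ (or_intror erefl)) := counting_off_grid R n2.
rewrite /grid_sets /= off_gridP => bc2.
have /hphi/counting_off_grid_le : tsat (fun=> grid n1) phi (off_grid R n1).
  by apply/(bcE _ (or_introl erefl)); rewrite /grid_sets /= off_gridP.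
by rewrite ltnS leqNgt n12.
Qed.
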